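(* Let $g \geq 2$ be an integer. There is $N_0 = N_0(g)$ such that for all $N \geq N_0$, every $B_3[g]$-set $A \subseteq [N]$ satisfies \[ |A| < (14.3\, g N)^{1/3}. \]
   Context: $[N] = \{1,2,\dots,N\}$. For positive integers $h,g$, a set $A \subseteq [N]$ is a $B_h[g]$-set if for every integer $n$ there are at most $g$ distinct multisets $\{a_1,\dots,a_h\}$ of size $h$ with all $a_i \in A$ and $a_1 + \dots + a_h = n$. *)

(* Defs.v *)
From mathcomp Require Import all_boot.
Set Implicit Arguments. Unset Strict Implicit. Unset Printing Implicit Defensive.

Fixpoint tuples_of (h : nat) (A : seq nat) : seq (seq nat) :=
  if h is h'.+1 then [seq x :: s | x <- A, s <- tuples_of h' A] else [:: [::]].

(* Number of multisets {a_1,...,a_h} with all a_i in A and a_1+...+a_h = n.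
   For A duplicate-free, multisets of size h correspond bijectively to the
   nondecreasing length-h sequences over A. *)
Definition rep_count (h : nat) (A : seq nat) (n : nat) : nat :=
  count (fun s => sorted leq s && (sumn s == n)) (tuples_of h A).

Definition Bhg_set (h g : nat) (A : seq nat) : Prop :=
  forall n : nat, rep_count h A n <= g.

(* Main.v *)
Require Import Defs.
From mathcomp Require Import all_boot all_order all_algebra.
From mathcomp Require Import reals trigo.
From mathcomp Require Import (canonicals) Rstruct.
From mathcomp Require Import ring lra zify.
Set Implicit Arguments.
Unset Strict Implicit.
Unset Printing Implicit Defensive.

(** Write [k = |A|], [S = u_a + u_b + u_c] with [u_a = 2 pi a / 3N - pi/3] in
    [[-pi/3, pi/3]], and [z_j] for the mean of [e^(i j u_a)] over [A].  The sums
    [a + b + c] fall in one period [3N] and each is attained by at most [6g]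
    ordered triples, so every nonnegative trigonometric polynomial [P] with
    constant term [p0] satisfies [sum_(a,b,c) P(S) <= 18 g N p0], whereas the left
    side equals [k^3 (p0 + sum_j Re (c_j z_j^3))], [c_j] being the coefficients of
    [P].  Suppose [k^3 >= 14.3 g N].

    Taking [P = 1 + cos (j (s - theta))] yields [|z_j| <= 0.638] for [j = 1, 3].
    As [cos 3u <= 4 cos u - 3] when [cos u >= 1/2], this forces
    [Re z_1 >= 0.59]: the angles cannot all stay near the endpoints [+-pi/3].
    In turn [z_2] is small, and [P = (4 cos (s - theta) + 3)^2], with [theta]
    the argument of [z_1^3], bounds [24 |z_1|^3 - 8 |z_2|^3] by a constant that
    these estimates exceed. *)

(** * Triple sums over a set and its representation counts *)

Section Representations.
Import Order.TTheory GRing.Theory Num.Theory.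
Local Open Scope ring_scope.
Variable R : numDomainType.
Implicit Types (f : nat -> R) (A : seq nat).

Lemma sum_tuples_ofS h A (F : seq nat -> R) :
  \sum_(s <- tuples_of h.+1 A) F s =
  \sum_(a <- A) \sum_(s <- tuples_of h A) F (a :: s).
Proof. exact: big_allpairs_dep. Qed.

Lemma rep_count3E A n :
  (rep_count 3 A n)%:R = \sum_(a <- A) \sum_(b <- A) \sum_(c <- A)
     ((a <= b <= c)%N && (a + b + c == n)%N)%:R :> R.
Proof.
rewrite /rep_count -sum1_count big_mkcond natr_sum sum_tuples_ofS.
apply: eq_bigr => a _; rewrite sum_tuples_ofS; apply: eq_bigr => b _.
rewrite sum_tuples_ofS; apply: eq_bigr => c _.
by rewrite big_seq1 /= andbT addn0 addnA; case: (_ && _).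
Qed.

Lemma sum_sorted3_rep_count A f (L : nat) :
    (forall a b c, a \in A -> b \in A -> c \in A -> 0 < a + b + c <= L)%N ->
  \sum_(a <- A) \sum_(b <- A) \sum_(c <- A) (a <= b <= c)%N%:R * f (a + b + c)%N =
  \sum_(1 <= n < L.+1) (rep_count 3 A n)%:R * f n.
Proof.
move=> AL; under [RHS]eq_bigr do rewrite rep_count3E mulr_suml.
rewrite [RHS]exchange_big; apply: eq_big_seq => a aA /=.
under [RHS]eq_bigr do rewrite mulr_suml.
rewrite [RHS]exchange_big; apply: eq_big_seq => b bA /=.
under [RHS]eq_bigr do rewrite mulr_suml.
rewrite [RHS]exchange_big; apply: eq_big_seq => c cA /=.
(* A fixed triple contributes to a single [n], its own sum, which lies in the range by [AL]. *)
rewrite (bigD1_seq (a + b + c)%N) ?iota_uniq //=; last first.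
  by rewrite mem_index_iota ltnS AL.
rewrite eqxx andbT big1 ?addr0// => n /negPf nabc.
by rewrite eq_sym nabc andbF mul0r.
Qed.

(* Some ordering of each triple is nondecreasing; the six orderings contribute
   equally. *)
Lemma sum3_le_sorted A f : (forall n, 0 <= f n) ->
  \sum_(a <- A) \sum_(b <- A) \sum_(c <- A) f (a + b + c)%N <=
  6 * \sum_(a <- A) \sum_(b <- A) \sum_(c <- A)
        (a <= b <= c)%N%:R * f (a + b + c)%N.
Proof.
move=> f0; pose T (F : nat -> nat -> nat -> R) :=
  \sum_(a <- A) \sum_(b <- A) \sum_(c <- A) F a b c.
have TD F G : T (fun a b c => F a b c + G a b c) = T F + T G.
  rewrite /T -big_split; apply: eq_bigr => a _; rewrite -big_split.
  by apply: eq_bigr => b _; rewrite -big_split.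
have T12 F : T (fun a b c => F b a c) = T F by rewrite /T exchange_big.
have T23 F : T (fun a b c => F a c b) = T F.
  by apply: eq_bigr => a _; rewrite exchange_big.
pose F a b c := (a <= b <= c)%N%:R * f (a + b + c)%N.
have Tbca : T (fun a b c => F b c a) = T F.
  by rewrite -(T23 F) -(T12 (fun a b c => F a c b)).
have Tcab : T (fun a b c => F c a b) = T F.
  by rewrite -(T12 F) -(T23 (fun a b c => F b a c)).
have Tcba : T (fun a b c => F c b a) = T F.
  by rewrite -Tbca -(T23 (fun a b c => F b c a)).
have <- : T (fun a b c => F a b c + F b a c + (F a c b + F b c a) +
                          (F c a b + F c b a)) = 6 * T F.
  by rewrite !TD (T12 F) (T23 F) Tbca Tcab Tcba; ring.
apply: ler_sum => a _; apply: ler_sum => b _; apply: ler_sum => c _; rewrite /F.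
have -> : (b + a + c = a + b + c)%N by lia.
have -> : (a + c + b = a + b + c)%N by lia.
have -> : (b + c + a = a + b + c)%N by lia.
have -> : (c + a + b = a + b + c)%N by lia.
have -> : (c + b + a = a + b + c)%N by lia.
rewrite -!mulrDl -!natrD -[leLHS]mul1r.
by apply: ler_wpM2r => //; rewrite ler1n; lia.
Qed.

Lemma sum3_le_Bhg A f (g L : nat) : Bhg_set 3 g A ->
    (forall a b c, a \in A -> b \in A -> c \in A -> 0 < a + b + c <= L)%N ->
    (forall n, 0 <= f n) ->
  \sum_(a <- A) \sum_(b <- A) \sum_(c <- A) f (a + b + c)%N <=
  6 * g%:R * \sum_(1 <= n < L.+1) f n.
Proof.
move=> Ag AL f0; apply: (le_trans (sum3_le_sorted A f0)).
rewrite (sum_sorted3_rep_count _ AL) -mulrA ler_wpM2l// mulr_sumr.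
by apply: ler_sum => n _; rewrite ler_wpM2r// ler_nat Ag.
Qed.

End Representations.

(** * Trigonometric sums over a full period and over the set *)

Section TrigonometricSums.
Import Order.TTheory GRing.Theory Num.Theory.
Local Open Scope ring_scope.
Variable R : realType.
Implicit Types (u v x : R) (A : seq nat).

Lemma cos_mul2 x : cos (2 * x) = 2 * cos x ^+ 2 - 1.
Proof. by rewrite mulr_natl cos_mulr2n mulr_natl. Qed.

Lemma sin_mul2 x : sin (2 * x) = 2 * (cos x * sin x).
Proof. by rewrite mulr_natl sin_mulr2n mulr_natl. Qed.

Lemma cos_mul3 x : cos (3 * x) = 4 * cos x ^+ 3 - 3 * cos x.
Proof.
have -> : 3 * x = 2 * x + x by ring.
rewrite cosD cos_mul2 sin_mul2.
transitivity ((2 * cos x ^+ 2 - 1) * cos x - 2 * cos x * sin x ^+ 2); first ring.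
by rewrite sin2cos2; ring.
Qed.

(** The triple-angle formula makes y = cos (pi/3) a root of 4y^3 - 3y + 1 = (y + 1)(2y - 1)^2, and y
    > 0. *)
Lemma cos_pi3 : cos (pi / 3) = 1 / 2 :> R.
Proof.
have := cos_mul3 (pi / 3); rewrite mulrC divfK ?pnatr_eq0// cospi => y3.
have y0 : 0 < cos (pi / 3) :> R.
  by apply: cos_gt0_pihalf; have := pi_gt0 R; lra.
have : (cos (pi / 3) + 1) * (2 * cos (pi / 3) - 1) ^+ 2 = 0 :> R by lra.
by move/eqP; rewrite mulf_eq0 sqrf_eq0 => /orP[]/eqP; lra.
Qed.

Lemma cos_ge_half u : `|u| <= pi / 3 -> 1 / 2 <= cos u.
Proof.
move=> u_le; rewrite -cos_norm -cos_pi3 leNgt; apply/negP.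
have := pi_gt0 R; have := normr_ge0 u => u0 pi0.
by rewrite ltr_cos ?in_itv/=; lra.
Qed.

(** Multiplying by 2 sin h, with h = j pi / L in (0, pi), makes the sum telescope; the two end terms
    differ by j full turns. *)
Lemma sum_cos_period (L j : nat) (th : R) : (0 < j < L)%N ->
  \sum_(1 <= n < L.+1) cos (j%:R * (n%:R * (2 * pi / L%:R)) + th) = 0.
Proof.
move=> /andP[j0 jL]; pose h : R := j%:R * (pi / L%:R).
have L0 : (0 : R) < L%:R by rewrite ltr0n (leq_trans _ jL).
have h0 : 0 < sin h.
  have jL1 : j%:R / L%:R < 1 :> R by rewrite ltr_pdivrMr// mul1r ltr_nat.
  have -> : h = pi * (j%:R / L%:R) by rewrite /h mulrCA.
  apply: sin_gt0_pi; rewrite mulr_gt0 ?divr_gt0 ?ltr0n ?pi_gt0 ?(leq_trans _ jL)//=.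
  by rewrite gtr_pMr ?pi_gt0.
apply: (mulfI (lt0r_neq0 h0)); rewrite mulr0.
apply: (mulfI (_ : 2 != 0)); first by rewrite pnatr_eq0.
rewrite mulr0 !mulr_sumr.
pose f n := sin (2 * n%:R * h - h + th).
rewrite (eq_bigr (fun n => f n.+1 - f n)) => [|n _]; last first.
  rewrite /f; have -> : j%:R * (n%:R * (2 * pi / L%:R)) = 2 * n%:R * h.
    by rewrite /h; ring.
  have -> : 2 * n.+1%:R * h - h + th = (2 * n%:R * h + th) + h.
    by rewrite -natr1; ring.
  have -> : 2 * n%:R * h - h + th = (2 * n%:R * h + th) - h by ring.
  by rewrite sinD sinB; ring.
rewrite telescope_sumr// /f.
have -> : 2 * L.+1%:R * h - h + th = (2 * 1%:R * h - h + th) + (pi *+ 2) *+ j.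
  have Lh : L%:R * h = j%:R * pi.
    by rewrite /h mulrCA [_ * (pi / _)]mulrC divfK// lt0r_neq0.
  rewrite -[_ *+ j]mulr_natl -[pi *+ 2]mulr_natl [_ * (2 * pi)]mulrCA -Lh -(natr1 L).
  ring.
by rewrite (periodicn (@sinD2pi R)) subrr.
Qed.

Lemma sum_sin_period (L j : nat) (th : R) : (0 < j < L)%N ->
  \sum_(1 <= n < L.+1) sin (j%:R * (n%:R * (2 * pi / L%:R)) + th) = 0.
Proof.
move=> jL; rewrite -[RHS](sum_cos_period (th - pi / 2) jL).
by apply: eq_bigr => n _; rewrite addrA cosBpihalf.
Qed.

(** These are the real and imaginary parts of (C + iD)^3, the cube of the sum of e^(i v_a). *)
Lemma sum3_cos_sin A (v : nat -> R) (C := \sum_(a <- A) cos (v a))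
    (D := \sum_(a <- A) sin (v a)) :
  \sum_(a <- A) \sum_(b <- A) \sum_(c <- A) cos (v a + v b + v c) =
    C ^+ 3 - 3 * C * D ^+ 2 /\
  \sum_(a <- A) \sum_(b <- A) \sum_(c <- A) sin (v a + v b + v c) =
    3 * C ^+ 2 * D - D ^+ 3.
Proof.
have cosS x : \sum_(c <- A) cos (x + v c) = cos x * C - sin x * D.
  by rewrite !mulr_sumr -sumrB; apply: eq_bigr => c _; rewrite cosD.
have sinS x : \sum_(c <- A) sin (x + v c) = sin x * C + cos x * D.
  by rewrite !mulr_sumr -big_split; apply: eq_bigr => c _; rewrite sinD.
split.
- transitivity (\sum_(a <- A) (cos (v a) * (C ^+ 2 - D ^+ 2) - sin (v a) * (2 * C * D))).
    apply: eq_bigr => a _; under eq_bigr do rewrite cosS.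
    by rewrite sumrB -!mulr_suml cosS sinS; ring.
  by rewrite sumrB -!mulr_suml -/C -/D; ring.
- transitivity (\sum_(a <- A) (sin (v a) * (C ^+ 2 - D ^+ 2) + cos (v a) * (2 * C * D))).
    apply: eq_bigr => a _; under eq_bigr do rewrite sinS.
    by rewrite big_split -!mulr_suml cosS sinS /=; ring.
  by rewrite big_split -!mulr_suml -/C -/D /=; ring.
Qed.

Definition centered_angle (N a : nat) : R := a%:R * (2 * pi / (3 * N)%:R) - pi / 3.

Lemma centered_angle_le (N a : nat) : (1 <= a <= N)%N -> `|centered_angle N a| <= pi / 3.
Proof.
move=> /andP[a1 aN]; have N0 : (0 : R) < N%:R by rewrite ltr0n (leq_trans a1).
have pi0 := pi_gt0 R.
have -> : centered_angle N a = pi / 3 * (2 * (a%:R / N%:R) - 1).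
  rewrite /centered_angle natrM; field; exact: lt0r_neq0.
have pi3 : 0 < pi / 3 :> R by lra.
rewrite normrM (gtr0_norm pi3) -[leRHS]mulr1 ler_wpM2l ?(ltW pi3)//.
have aN0 : 0 <= a%:R / N%:R :> R by rewrite divr_ge0 ?ler0n.
have aN1 : a%:R / N%:R <= 1 :> R by rewrite ler_pdivrMr// mul1r ler_nat.
by rewrite ler_norml; lra.
Qed.

Definition cos_sum N A (j : nat) : R := \sum_(a <- A) cos (j%:R * centered_angle N a).
Definition sin_sum N A (j : nat) : R := \sum_(a <- A) sin (j%:R * centered_angle N a).

(* The left side is the sum of the test polynomial over all triples: its cubic
   terms are the real and imaginary parts of [(C j + i D j)^3]. *)
Lemma Bhg_trig_test A (g N d : nat) (p0 : R) (p q : nat -> R)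
    (C := cos_sum N A) (D := sin_sum N A) :
    Bhg_set 3 g A -> {in A, forall a, 1 <= a <= N}%N -> (d <= 3 * N)%N ->
    (forall x, 0 <= p0 + \sum_(1 <= j < d) (p j * cos (j%:R * x) + q j * sin (j%:R * x))) ->
  p0 * (size A)%:R ^+ 3 + \sum_(1 <= j < d)
     (p j * (C j ^+ 3 - 3 * C j * D j ^+ 2) + q j * (3 * C j ^+ 2 * D j - D j ^+ 3))
  <= 18 * g%:R * N%:R * p0.
Proof.
move=> Ag AN dN P0; set del : R := 2 * pi / (3 * N)%:R.
pose P x := p0 + \sum_(1 <= j < d) (p j * cos (j%:R * x) + q j * sin (j%:R * x)).
have A3 a b c : a \in A -> b \in A -> c \in A -> (0 < a + b + c <= 3 * N)%N.
  by move=> /AN ? /AN ? /AN ?; lia.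
have := sum3_le_Bhg Ag A3 (fun n => P0 (n%:R * del - pi)).
rewrite -!/(P _).
(* Every frequency satisfies 0 < j < 3N and averages to zero over the period, so only the constant
   term survives. *)
have -> : \sum_(1 <= n < (3 * N).+1) P (n%:R * del - pi) = 3 * N%:R * p0.
  rewrite big_split /= sumr_const_nat subn1 /= exchange_big_nat /=.
  rewrite big1_seq ?addr0 => [|j].
    by rewrite -[LHS]mulr_natl natrM.
  rewrite /= mem_index_iota => /andP[j1 jd].
  rewrite big_split -!mulr_sumr /=.
  under eq_bigr do rewrite mulrBr.
  under [X in _ + _ * X]eq_bigr do rewrite mulrBr.
  by rewrite sum_cos_period ?sum_sin_period ?mulr0 ?addr0// j1 (leq_trans jd).
have -> : \sum_(a <- A) \sum_(b <- A) \sum_(c <- A) P ((a + b + c)%:R * del - pi) =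
  p0 * (size A)%:R ^+ 3 + \sum_(1 <= j < d)
     (p j * (C j ^+ 3 - 3 * C j * D j ^+ 2) + q j * (3 * C j ^+ 2 * D j - D j ^+ 3)).
  pose T (F : nat -> nat -> nat -> R) :=
    \sum_(a <- A) \sum_(b <- A) \sum_(c <- A) F a b c.
  have TD F G : T (fun a b c => F a b c + G a b c) = T F + T G.
    rewrite /T -big_split; apply: eq_bigr => a _; rewrite -big_split.
    by apply: eq_bigr => b _; rewrite -big_split.
  have TZ x F : T (fun a b c => x * F a b c) = x * T F.
    rewrite /T mulr_sumr; apply: eq_bigr => a _; rewrite mulr_sumr.
    by apply: eq_bigr => b _; rewrite mulr_sumr.
  have Tsum (F : nat -> nat -> nat -> nat -> R) :
      T (fun a b c => \sum_(1 <= j < d) F j a b c) = \sum_(1 <= j < d) T (F j).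
    rewrite /T [RHS]exchange_big; apply: eq_bigr => a _.
    rewrite [RHS]exchange_big; apply: eq_bigr => b _.
    by rewrite [RHS]exchange_big.
  have T1 : T (fun _ _ _ => 1) = (size A)%:R ^+ 3.
    by rewrite /T !big_const_seq !count_predT !iter_addr_0 -!mulrnA -natrX;
       congr _%:R; lia.
  pose u := centered_angle N.
  transitivity (T (fun a b c => p0 * 1 + \sum_(1 <= j < d)
      (p j * cos (j%:R * u a + j%:R * u b + j%:R * u c) +
       q j * sin (j%:R * u a + j%:R * u b + j%:R * u c)))).
    apply: eq_bigr => a _; apply: eq_bigr => b _; apply: eq_bigr => c _.
    (* The three shifts by pi/3 add up to the shift by pi. *)
    have -> : (a + b + c)%:R * del - pi = u a + u b + u c.
      by rewrite /u /centered_angle -/del !natrD; field.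
    by rewrite mulr1; congr (_ + _); apply: eq_bigr => j _; rewrite !mulrDr.
  rewrite TD TZ T1 Tsum; congr (_ + _); apply: eq_bigr => j _; rewrite TD !TZ.
  by have [cE sE] := sum3_cos_sin A (fun a => j%:R * u a); rewrite /T cE sE.
by move=> /le_trans; apply; rewrite le_eqVlt; apply/orP; left; apply/eqP; ring.
Qed.

End TrigonometricSums.

(** * Plane geometry of the moments and the final numerical estimate *)

Section Moments.
Import Order.TTheory GRing.Theory Num.Theory.
Local Open Scope ring_scope.
Variable R : rcfType.
Implicit Types x y p q c s : R.

(** Cauchy-Schwarz, from Lagrange's identity with remainder (py - qx)^2. *)
Lemma dot_unit_ge x y p q : p ^+ 2 + q ^+ 2 = 1 ->
  - Num.sqrt (x ^+ 2 + y ^+ 2) <= p * x + q * y.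
Proof.
move=> pq; have : `|p * x + q * y| <= Num.sqrt (x ^+ 2 + y ^+ 2).
  rewrite -sqrtr_sqr ler_wsqrtr// -[leRHS]mul1r -pq.
  have := sqr_ge0 (p * y - q * x); nra.
by rewrite ler_norml => /andP[].
Qed.

(** Supplies (cos theta, sin theta) for the argument theta of x + iy, so that no angle has to be
    constructed; at the origin any unit vector serves. *)
Lemma dot_unit_max x y : exists p q,
  p ^+ 2 + q ^+ 2 = 1 /\ p * x + q * y = Num.sqrt (x ^+ 2 + y ^+ 2).
Proof.
set r := Num.sqrt _; have r0 : 0 <= r := sqrtr_ge0 _.
have r2 : r ^+ 2 = x ^+ 2 + y ^+ 2 by rewrite sqr_sqrtr// addr_ge0 ?sqr_ge0.
have [rE|r_neq0] := eqVneq r 0; last first.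
  exists (x / r), (y / r); split.
    by rewrite !expr_div_n -mulrDl -r2 divff// sqrf_eq0.
  by rewrite mulrAC [y / r * y]mulrAC -mulrDl -!expr2 -r2 expr2 mulfK.
move/eqP: (r2); rewrite rE expr0n/= eq_sym paddr_eq0 ?sqr_ge0// !sqrf_eq0.
by move=> /andP[/eqP-> /eqP->]; exists 1, 0; split; ring.
Qed.

Lemma sqrt_norm_cube x y :
  Num.sqrt ((x ^+ 3 - 3 * x * y ^+ 2) ^+ 2 + (3 * x ^+ 2 * y - y ^+ 3) ^+ 2) =
  Num.sqrt (x ^+ 2 + y ^+ 2) ^+ 3.
Proof.
have n0 : 0 <= x ^+ 2 + y ^+ 2 by rewrite addr_ge0 ?sqr_ge0.
rewrite -[RHS]ger0_norm ?exprn_ge0 ?sqrtr_ge0// -sqrtr_sqr -exprM mulnC exprM.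
by rewrite sqr_sqrtr//; congr Num.sqrt; ring.
Qed.

(** Here 37/143 = 18/14.3 - 1, and 0.638 is its cube root rounded up. *)
Lemma le_of_cube_le r : r ^+ 3 <= 37 / 143 -> r <= 319 / 500 :> R.
Proof.
move=> r3; rewrite leNgt; apply/negP => r_gt.
have : (319 / 500) ^+ 3 < r ^+ 3 by rewrite ltrXn2r//; lra.
lra.
Qed.

(* [c1 + i s1] and [c2 + i s2] stand for [z_1] and [z_2].  The cubes are reduced
   to squares: [|z_2| <= 0.51], and [|z_1|^3 >= 0.9 |z_1|^2 - 0.108] by the tangent
   at [0.6]. *)
Lemma moments_contra c1 s1 c2 s2 :
  59 / 100 <= c1 ->
  Num.sqrt (c1 ^+ 2 + s1 ^+ 2) <= 319 / 500 ->
  43 / 25 - 12 / 5 * c1 + c2 >= 0 -> c2 <= 3 * c1 - 2 ->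
  `|s2 - s1| <= 87 / 100 * (2 * c1 - 1) ->
  17 * (37 / 143) <
    24 * Num.sqrt (c1 ^+ 2 + s1 ^+ 2) ^+ 3 - 8 * Num.sqrt (c2 ^+ 2 + s2 ^+ 2) ^+ 3.
Proof.
move=> c1_ge r_le c2_ge c2_le s2_le.
have r0 := sqrtr_ge0 (c1 ^+ 2 + s1 ^+ 2).
have r2 : Num.sqrt (c1 ^+ 2 + s1 ^+ 2) ^+ 2 = c1 ^+ 2 + s1 ^+ 2.
  by rewrite sqr_sqrtr// addr_ge0 ?sqr_ge0.
have t0 := sqrtr_ge0 (c2 ^+ 2 + s2 ^+ 2).
have t2 : Num.sqrt (c2 ^+ 2 + s2 ^+ 2) ^+ 2 = c2 ^+ 2 + s2 ^+ 2.
  by rewrite sqr_sqrtr// addr_ge0 ?sqr_ge0.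
move: (Num.sqrt _) r_le r0 r2 (Num.sqrt _) t0 t2 => r r_le r0 r2 t t0 t2.
have c1_le : c1 <= 319 / 500.
  by apply: le_trans r_le; rewrite -ler_sqr ?nnegrE ?r2 ?lerDl ?sqr_ge0//; lra.
(* The upper bound 3 c1 - 2 makes c2 negative, so its lower bound controls the square. *)
have c2abs : c2 ^+ 2 <= (43 / 25 - 12 / 5 * c1) ^+ 2.
  by rewrite -sqrrN ler_sqr ?nnegrE; lra.
have [S [S0 S2 s2_leS]] : exists S, [/\ 0 <= S, S ^+ 2 = s1 ^+ 2 &
    s2 ^+ 2 <= (S + 87 / 100 * (2 * c1 - 1)) ^+ 2].
  exists `|s1|; split; rewrite ?normr_ge0 ?real_normK ?num_real//.
  have -> : s2 ^+ 2 = `|s2| ^+ 2 by rewrite real_normK ?num_real.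
  rewrite ler_sqr ?nnegrE ?normr_ge0//; last first.
    by rewrite addr_ge0 ?normr_ge0//; lra.
  by have := ler_normD s1 (s2 - s1); rewrite addrCA subrr addr0; lra.
have r2_le : r ^+ 2 <= (319 / 500) ^+ 2 by rewrite ler_sqr ?nnegrE//; lra.
have S2_le : S ^+ 2 <= (319 / 500) ^+ 2 - c1 ^+ 2 by lra.
have S_le : S <= 61 / 250.
  have c12 : (59 / 100) ^+ 2 <= c1 ^+ 2 by rewrite ler_sqr ?nnegrE//; lra.
  by rewrite -ler_sqr ?nnegrE//; lra.
have t2_le : t ^+ 2 <= (51 / 100) ^+ 2.
  have Sc : S * (2 * c1 - 1) <= 61 / 250 * (2 * c1 - 1) by rewrite ler_wpM2r//; lra.
  have : 0 <= (c1 - 59 / 100) * (319 / 500 - c1) by rewrite mulr_ge0//; lra.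
  nra.
have t_le : t <= 51 / 100 by rewrite -ler_sqr ?nnegrE//; lra.
have t3 : t ^+ 3 <= 51 / 100 * t ^+ 2 by rewrite exprS ler_wpM2r ?sqr_ge0.
have r3 : 9 / 10 * r ^+ 2 - 27 / 250 <= r ^+ 3.
  rewrite -subr_ge0.
  have -> : r ^+ 3 - (9 / 10 * r ^+ 2 - 27 / 250) =
            (r - 3 / 5) ^+ 2 * (r + 3 / 10) by field.
  by rewrite mulr_ge0 ?sqr_ge0//; lra.
suff : 17 * (37 / 143) < 24 * (9 / 10 * r ^+ 2 - 27 / 250)
   - 8 * (51 / 100 * t ^+ 2) by lra.
rewrite r2 t2 -S2.
(* Inserting the bounds on c2 and s2 leaves a quadratic in c1 and S, concave in c1 and convex in S.
   The two products linearise c1^2 and c1 S; the tangent at S = 1/25, near the minimum for c1 =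
   0.59, linearises S^2. *)
have cc : 0 <= (c1 - 59 / 100) * (319 / 500 - c1) by rewrite mulr_ge0//; lra.
have cS : 0 <= (c1 - 59 / 100) * (61 / 250 - S) by rewrite mulr_ge0//; lra.
have SS := sqr_ge0 (S - 1 / 25).
lra.
Qed.

End Moments.

(** * Moments of a large set: bounds from the arc, then from the test polynomials *)

Section LargeSet.
Import Order.TTheory GRing.Theory Num.Theory.
Local Open Scope ring_scope.
Variable R : realType.
Variables (A : seq nat) (N : nat).
Hypothesis AN : {in A, forall a, 1 <= a <= N}%N.
Hypothesis A0 : (0 < size A)%N.

Let mean (f : R -> R) := (\sum_(a <- A) f (centered_angle R N a)) / (size A)%:R.

Let le_mean f h : (forall u, 1 / 2 <= cos u -> f u <= h u) -> mean f <= mean h.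
Proof.
move=> fh; rewrite ler_pM2r ?invr_gt0 ?ltr0n//.
rewrite big_seq [leRHS]big_seq; apply: ler_sum => a aA.
by apply/fh/cos_ge_half/centered_angle_le/AN.
Qed.

Let meanD f h : mean (fun u => f u + h u) = mean f + mean h.
Proof. by rewrite /mean big_split mulrDl. Qed.

Let meanZ x f : mean (fun u => x * f u) = x * mean f.
Proof. by rewrite /mean -mulr_sumr mulrA. Qed.

Let mean_cst x : mean (fun=> x) = x.
Proof.
rewrite /mean big_const_seq count_predT iter_addr_0 -[x *+ _]mulr_natr mulfK//.
by rewrite pnatr_eq0 -lt0n.
Qed.

Let zc j : R := cos_sum R N A j / (size A)%:R.
Let zs j : R := sin_sum R N A j / (size A)%:R.

Let zcE j : zc j = mean (fun u => cos (j%:R * u)). Proof. by []. Qed.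
Let zsE j : zs j = mean (fun u => sin (j%:R * u)). Proof. by []. Qed.

Let zc1E : zc 1 = mean cos.
Proof. by congr (_ / _); apply: eq_bigr => a _; rewrite mul1r. Qed.

Let zs1E : zs 1 = mean sin.
Proof. by congr (_ / _); apply: eq_bigr => a _; rewrite mul1r. Qed.

Lemma mean_cos3_le : zc 3 <= 4 * zc 1 - 3.
Proof.
rewrite zcE zc1E -meanZ -(mean_cst (-3)) -meanD; apply: le_mean => u uhalf.
rewrite cos_mul3 -subr_ge0.
have -> : 4 * cos u - 3 - (4 * cos u ^+ 3 - 3 * cos u) =
  (1 - cos u) * (2 * cos u - 1) * (2 * cos u + 3) by ring.
by rewrite !mulr_ge0//; have := cos_le1 u; lra.
Qed.

(** Again a chord over [1/2, 1], now of 2x^2 - 1. *)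
Lemma mean_cos2_le : zc 2 <= 3 * zc 1 - 2.
Proof.
rewrite zcE zc1E -meanZ -(mean_cst (-2)) -meanD; apply: le_mean => u uhalf.
rewrite cos_mul2 -subr_ge0.
have -> : 3 * cos u - 2 - (2 * cos u ^+ 2 - 1) = (1 - cos u) * (2 * cos u - 1) by ring.
by rewrite mulr_ge0//; have := cos_le1 u; lra.
Qed.

(** The tangent of 2x^2 - 1 at x = 3/5, inside the range [0.59, 0.638] where [zc 1] will lie. *)
Lemma mean_cos2_ge : 12 / 5 * zc 1 - 43 / 25 <= zc 2.
Proof.
rewrite (zcE 2) zc1E -meanZ -(mean_cst (- (43 / 25))) -meanD.
apply: le_mean => u _; rewrite cos_mul2.
by have := sqr_ge0 (cos u - 3 / 5); lra.
Qed.

(** On the arc |sin u| is at most sqrt 3 / 2 < 0.87, and sin 2u - sin u = sin u (2 cos u - 1). *)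
Lemma mean_sin2_near : `|zs 2 - zs 1| <= 87 / 100 * (2 * zc 1 - 1).
Proof.
have -> : 87 / 100 * (2 * zc 1 - 1) = mean (fun u => 87 / 100 * (2 * cos u - 1)).
  by rewrite meanZ meanD meanZ mean_cst zc1E.
have sin_le (u : R) : 1 / 2 <= cos u ->
    `|sin (2 * u) - sin u| <= 87 / 100 * (2 * cos u - 1).
  move=> uhalf; have -> : sin (2 * u) - sin u = sin u * (2 * cos u - 1).
    by rewrite sin_mul2; ring.
  have c0 : 0 <= 2 * cos u - 1 by lra.
  rewrite normrM (ger0_norm c0) ler_wpM2r//.
  rewrite -ler_sqr ?nnegrE ?normr_ge0//; last lra.
  rewrite real_normK ?num_real// sin2cos2.
  have : (1 / 2) ^+ 2 <= cos u ^+ 2 by rewrite ler_sqr ?nnegrE//; lra.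
  lra.
have -> : zs 2 - zs 1 = mean (fun u => sin (2 * u) - sin u).
  by rewrite meanD zsE zs1E /mean sumrN mulNr.
rewrite ler_norml -[- mean _]mulN1r -meanZ; apply/andP; split; apply: le_mean => u /sin_le.
  by rewrite ler_norml => /andP[] ? _; rewrite mulN1r.
by rewrite ler_norml => /andP[].
Qed.

Variable g : nat.
Hypothesis Ag : Bhg_set 3 g A.
Hypothesis N2 : (2 <= N)%N.
Hypothesis A_large : (143 * g * N <= 10 * size A ^ 3)%N.

Let re3 j := zc j ^+ 3 - 3 * zc j * zs j ^+ 2.
Let im3 j := 3 * zc j ^+ 2 * zs j - zs j ^+ 3.

(** [Bhg_trig_test] divided by k^3; the factor 180/143 is 18/14.3. *)
Lemma mean_trig_test (p0 : R) (p q : nat -> R) : 0 <= p0 ->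
    (forall x, 0 <= p0 + \sum_(1 <= j < 4) (p j * cos (j%:R * x) + q j * sin (j%:R * x))) ->
  p0 + \sum_(1 <= j < 4) (p j * re3 j + q j * im3 j) <= 180 / 143 * p0.
Proof.
move=> p00 P0; have k0 : 0 < (size A)%:R :> R by rewrite ltr0n.
have dN : (4 <= 3 * N)%N by lia.
have := Bhg_trig_test Ag AN dN P0.
set k : R := (size A)%:R in k0 *.
have kgN : 143 * (g%:R * N%:R) <= 10 * k ^+ 3.
  by rewrite /k -natrX -!natrM ler_nat mulnA.
move=> test; rewrite -(ler_pM2l (exprn_gt0 3 k0)).
have -> : k ^+ 3 * (p0 + \sum_(1 <= j < 4) (p j * re3 j + q j * im3 j)) =
  p0 * k ^+ 3 + \sum_(1 <= j < 4)
     (p j * (cos_sum R N A j ^+ 3 - 3 * cos_sum R N A j * sin_sum R N A j ^+ 2) +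
      q j * (3 * cos_sum R N A j ^+ 2 * sin_sum R N A j - sin_sum R N A j ^+ 3)).
  rewrite mulrDr mulr_sumr mulrC; congr (_ + _); apply: eq_bigr => j _.
  by rewrite /re3 /im3 /zc /zs -/k; field; exact: lt0r_neq0.
apply: (le_trans test).
have := ler_wpM2r p00 kgN; lra.
Qed.

Lemma norm_mean_le j : (0 < j < 4)%N ->
  Num.sqrt (zc j ^+ 2 + zs j ^+ 2) <= 319 / 500.
Proof.
move=> j4; have [p [q [pq1 pqE]]] := dot_unit_max (re3 j) (im3 j).
apply: le_of_cube_le; rewrite -sqrt_norm_cube -pqE.
have pick_j (F : nat -> R) : \sum_(1 <= i < 4) (i == j)%:R * F i = F j.
  rewrite (bigD1_seq j) ?iota_uniq ?mem_index_iota//= eqxx mul1r big1 ?addr0//.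
  by move=> i /negPf->; rewrite mul0r.
(* The test polynomial 1 + cos (jx - theta), with theta the argument of z_j^3, gives 1 + |z_j|^3 <=
   180/143. *)
have := @mean_trig_test 1 (fun i => (i == j)%:R * p) (fun i => (i == j)%:R * q) ler01.
under eq_bigr do rewrite -!mulrA -mulrDr.
rewrite pick_j mulr1 => test.
have /test : forall x, 0 <= 1 + \sum_(1 <= i < 4)
   ((i == j)%:R * p * cos (i%:R * x) + (i == j)%:R * q * sin (i%:R * x)).
  move=> x; under eq_bigr do rewrite -!mulrA -mulrDr.
  rewrite pick_j.
  have := dot_unit_ge (cos (j%:R * x)) (sin (j%:R * x)) pq1.
  by rewrite cos2Dsin2 sqrtr1; lra.
lra.
Qed.

Lemma square_test :
  24 * Num.sqrt (zc 1 ^+ 2 + zs 1 ^+ 2) ^+ 3 -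
  8 * Num.sqrt (zc 2 ^+ 2 + zs 2 ^+ 2) ^+ 3 <= 17 * (37 / 143).
Proof.
have [p [q [pq1 pqE]]] := dot_unit_max (re3 1) (im3 1).
(* This is the unit vector of angle 2 theta; the phase of z_2^3 is unknown, so its term is bounded
   below by -8 |z_2|^3. *)
have pq2 : (p ^+ 2 - q ^+ 2) ^+ 2 + (2 * p * q) ^+ 2 = 1.
  by transitivity ((p ^+ 2 + q ^+ 2) ^+ 2); [ring | rewrite pq1 expr1n].
have := dot_unit_ge (re3 2) (im3 2) pq2.
have sum3E (F : nat -> R) : \sum_(1 <= i < 4) F i = F 1%N + F 2%N + F 3%N.
  by rewrite unlock /= addr0 addrA.
(* The coefficients come from (4 cos t + 3)^2 = 17 + 24 cos t + 8 cos 2t. Entry 0 is a placeholder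
   since j starts at 1, and the default 0 of [nth] is the coefficient at j = 3. *)
have := @mean_trig_test 17 (nth 0 [:: 0; 24 * p; 8 * (p ^+ 2 - q ^+ 2)])
          (nth 0 [:: 0; 24 * q; 8 * (2 * p * q)]) (ler0n _ _).
rewrite sum3E /= => test.
have /test : forall x, 0 <= 17 + \sum_(1 <= j < 4)
   ((nth 0 [:: 0; 24 * p; 8 * (p ^+ 2 - q ^+ 2)]) j * cos (j%:R * x) +
    (nth 0 [:: 0; 24 * q; 8 * (2 * p * q)]) j * sin (j%:R * x)).
  move=> x; rewrite sum3E /= mul1r cos_mul2 sin_mul2.
  have cs := cos2Dsin2 x.
  suff -> : 17 + (24 * p * cos x + 24 * q * sin x +
      (8 * (p ^+ 2 - q ^+ 2) * (2 * cos x ^+ 2 - 1) +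
       8 * (2 * p * q) * (2 * (cos x * sin x))) +
      (0 * cos (3 * x) + 0 * sin (3 * x))) = (4 * (p * cos x + q * sin x) + 3) ^+ 2.
    exact: sqr_ge0.
  have -> : 17 = 9 + 8 * (p ^+ 2 + q ^+ 2) * (cos x ^+ 2 + sin x ^+ 2).
    by rewrite cs pq1; ring.
  have -> : 2 * cos x ^+ 2 - 1 = cos x ^+ 2 - sin x ^+ 2 by lra.
  ring.
rewrite !sqrt_norm_cube -/(re3 1) in pqE *.
lra.
Qed.

Lemma large_Bhg_contra : False.
Proof.
have r1 := @norm_mean_le 1 isT; have r3 := @norm_mean_le 3 isT.
have z3_ge : - (319 / 500) <= zc 3.
  have one2 : 1 ^+ 2 + 0 ^+ 2 = 1 :> R by ring.
  by have := dot_unit_ge (zc 3) (zs 3) one2; lra.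
(* Indeed (3 - 0.638) / 4 = 0.5905. *)
have c1_ge : 59 / 100 <= zc 1 by have := mean_cos3_le; lra.
have c2_ge : 43 / 25 - 12 / 5 * zc 1 + zc 2 >= 0 by have := mean_cos2_ge; lra.
have := moments_contra c1_ge r1 c2_ge mean_cos2_le mean_sin2_near.
by rewrite ltNge square_test.
Qed.

End LargeSet.

(* A subset of [N] is encoded as a duplicate-free list with entries in 1..N;
   |A| = size A.  |A| < (14.3 g N)^(1/3)  <=>  |A|^3 < 143/10 g N
   <=>  10 |A|^3 < 143 g N (all quantities nonnegative). *)
Theorem theorem1p1 (g : nat) (hg : 2 <= g) :
  exists N0 : nat, forall N : nat, N0 <= N ->
    forall A : seq nat, uniq A -> (forall a, a \in A -> 1 <= a <= N) ->
      Bhg_set 3 g A ->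
      10 * (size A) ^ 3 < 143 * g * N.
Proof.
(* N >= 2 ensures 3N >= 4, so the frequencies 1, 2, 3 all lie below the period. *)
exists 2 => N N2 A _ AN Ag; rewrite ltnNge; apply/negP => A_large.
have A0 : 0 < size A by case: (size A) A_large => //; nia.
exact: (@large_Bhg_contra Rdefinitions.R A N AN A0 g Ag N2 A_large).
Qed.
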